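(* Let $k$ be any field. Let $g\in k[[t]]$ be a power series such that $g(0)=0$ and $\frac{dg}{dt}\notin k(t,g)$. Then for the discrete valuation ring $V=k(t,g)\cap k[[t]]$, the inclusion $V\to D_k(V)$ (sending $v$ to multiplication by $v$) is an isomorphism.
   Context: $k(t,g)$ denotes the subfield of the fraction field $k((t))=k[[t]][\frac1t]$ of $k[[t]]$ generated over $k$ by $t$ and $g$; the intersection is taken in $k((t))$, and $\frac{d}{dt}$ is the formal derivative. $V$ is the valuation ring of the restriction of the $t$-adic valuation to $k(t,g)$. For a commutative $k$-algebra $S$: $D^0_k(S)=\mathrm{Hom}_S(S,S)$; for $n\ge1$, $\delta\in\mathrm{Hom}_k(S,S)$ lies in $D^n_k(S)$ iff $[\delta,s]=\delta\circ s-s\circ\delta\in D^{n-1}_k(S)$ for all $s\in S$; $D_k(S)=\bigcup_nD^n_k(S)$. *)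

(* Defs.v *)
From HB Require Import structures.
From mathcomp Require Import all_boot all_algebra.
From mathcomp Require Import generic_quotient.
From mathcomp Require Import boolp.

Set Implicit Arguments.
Unset Strict Implicit.
Unset Printing Implicit Defensive.

Import GRing.Theory.
Local Open Scope ring_scope.

Reserved Notation "{ 'fps' k }" (format "{ 'fps'  k }").
Reserved Notation "f ^`D" (at level 1, format "f ^`D").

Record fps (k : fieldType) := FPS { fps_coef :> nat -> k }.
Notation "{ 'fps' k }" := (fps k) : type_scope.

HB.instance Definition _ (k : fieldType) := [isNew for @fps_coef k].
HB.instance Definition _ (k : fieldType) := [Choice of {fps k} by <:].

Section PowerSeries.
Variable k : fieldType.
Implicit Types (f g h : {fps k}) (p q : {poly k}) (a : k) (n : nat).

Lemma fpsP f g : (forall n, f n = g n) -> f = g.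
Proof. by move=> fg; apply/val_inj/funext. Qed.

Definition fps_add f g : {fps k} := FPS (fun n => f n + g n).
Definition fps_opp f : {fps k} := FPS (fun n => - f n).
Definition fps_scale a f : {fps k} := FPS (fun n => a * f n).
Definition fps_mul f g : {fps k} :=
  FPS (fun n => \sum_(i < n.+1) f i * g (n - i)%N).
Definition fps_const a : {fps k} := FPS (fun n => if n is 0 then a else 0).

Fact fps_addA : associative fps_add.
Proof. by move=> f g h; apply: fpsP => n; exact: addrA. Qed.
Fact fps_addC : commutative fps_add.
Proof. by move=> f g; apply: fpsP => n; exact: addrC. Qed.
Fact fps_add0 : left_id (FPS (fun=> 0)) fps_add.
Proof. by move=> f; apply: fpsP => n; exact: add0r. Qed.
Fact fps_addN : left_inverse (FPS (fun=> 0)) fps_opp fps_add.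
Proof. by move=> f; apply: fpsP => n; exact: addNr. Qed.

HB.instance Definition _ := GRing.isZmodule.Build {fps k}
  fps_addA fps_addC fps_add0 fps_addN.

(* Ring identities are transferred from polynomials through truncation *)
Definition fps_trunc n f : {poly k} := \poly_(i < n) f i.

Definition agree n p f := forall i, (i <= n)%N -> p`_i = f i.

Lemma agree_trunc n f : agree n (fps_trunc n.+1 f) f.
Proof. by move=> i le_in; rewrite coef_poly ltnS le_in. Qed.

Lemma agreeM n p q f g :
  agree n p f -> agree n q g -> agree n (p * q) (fps_mul f g).
Proof.
move=> pf qg i le_in; rewrite coefM; apply: eq_bigr => j _.
rewrite pf ?qg //; first exact: leq_trans (leq_subr _ _) le_in.
by apply: leq_trans le_in; rewrite -ltnS.
Qed.

Lemma agreeD n p q f g : agree n p f -> agree n q g -> agree n (p + q) (f + g).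
Proof. by move=> pf qg i le_in; rewrite coefD pf ?qg. Qed.

Lemma agree1 n : agree n 1 (fps_const 1).
Proof. by move=> [|i] _; rewrite coef1. Qed.

Lemma agree_eq f g : (forall n, exists2 p, agree n p f & agree n p g) -> f = g.
Proof.
by move=> fg; apply: fpsP => n; have [p pf pg] := fg n; rewrite -pf // -pg.
Qed.

Fact fps_mulA : associative fps_mul.
Proof.
move=> f g h; apply: agree_eq => n.
have [af ag ah] := And3 (@agree_trunc n f) (@agree_trunc n g) (@agree_trunc n h).
exists (fps_trunc n.+1 f * (fps_trunc n.+1 g * fps_trunc n.+1 h)).
  by do 2?apply: agreeM.
by rewrite mulrA; do 2?apply: agreeM.
Qed.

Fact fps_mulC : commutative fps_mul.
Proof.
move=> f g; apply: agree_eq => n.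
have [af ag] := conj (@agree_trunc n f) (@agree_trunc n g).
exists (fps_trunc n.+1 f * fps_trunc n.+1 g); first exact: agreeM.
by rewrite mulrC; apply: agreeM.
Qed.

Fact fps_mul1 : left_id (fps_const 1) fps_mul.
Proof.
move=> f; apply: agree_eq => n; have af := @agree_trunc n f.
by exists (fps_trunc n.+1 f) => //; rewrite -[X in agree _ X _]mul1r;
  apply: agreeM => //; exact: agree1.
Qed.

Fact fps_mulDl : left_distributive fps_mul +%R.
Proof.
move=> f g h; apply: agree_eq => n.
have [af ag ah] := And3 (@agree_trunc n f) (@agree_trunc n g) (@agree_trunc n h).
exists ((fps_trunc n.+1 f + fps_trunc n.+1 g) * fps_trunc n.+1 h).
  by apply: agreeM => //; apply: agreeD.
by rewrite mulrDl; apply: agreeD; apply: agreeM.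
Qed.

Fact fps_oner_neq0 : fps_const 1 != 0.
Proof. by apply/eqP => /(congr1 (fun f : {fps k} => f 0%N)) /eqP; rewrite oner_eq0. Qed.

HB.instance Definition _ := GRing.Zmodule_isComNzRing.Build {fps k}
  fps_mulA fps_mulC fps_mul1 fps_mulDl fps_oner_neq0.

Fact fps_scaleA a b f : fps_scale a (fps_scale b f) = fps_scale (a * b) f.
Proof. by apply: fpsP => n; exact: mulrA. Qed.
Fact fps_scale1 : left_id 1 fps_scale.
Proof. by move=> f; apply: fpsP => n; exact: mul1r. Qed.
Fact fps_scaleDr : right_distributive fps_scale +%R.
Proof. by move=> a f g; apply: fpsP => n; exact: mulrDr. Qed.
Fact fps_scaleDl f : {morph fps_scale^~ f : a b / a + b}.
Proof. by move=> a b; apply: fpsP => n; exact: mulrDl. Qed.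

HB.instance Definition _ := GRing.Zmodule_isLmodule.Build k {fps k}
  fps_scaleA fps_scale1 fps_scaleDr fps_scaleDl.

Fact fps_scaleAl a f g : a *: (f * g) = (a *: f) * g.
Proof.
apply: fpsP => n; rewrite [LHS]mulr_sumr.
by apply: eq_bigr => i _; rewrite mulrA.
Qed.

HB.instance Definition _ := GRing.Lmodule_isLalgebra.Build k {fps k} fps_scaleAl.
HB.instance Definition _ := GRing.Lalgebra_isComAlgebra.Build k {fps k}.

Lemma fps_coefM f g n : (f * g) n = \sum_(i < n.+1) f i * g (n - i)%N.
Proof. by []. Qed.
Lemma fps_coefD f g n : (f + g) n = f n + g n. Proof. by []. Qed.
Lemma fps_coefN f n : (- f) n = - f n. Proof. by []. Qed.
Lemma fps_coefZ a f n : (a *: f) n = a * f n. Proof. by []. Qed.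
Lemma fps_coef0 n : (0 : {fps k}) n = 0. Proof. by []. Qed.
Lemma fps_coef1 n : (1 : {fps k}) n = (n == 0%N)%:R. Proof. by case: n. Qed.

(* The first n coefficients of f^-1, given by the usual recursion. *)
Fixpoint fps_invs f n : seq k :=
  if n is m.+1 then
    let s := fps_invs f m in
    rcons s (if m is 0 then (f 0%N)^-1
             else - (\sum_(i < m) s`_i * f (m - i)%N) / f 0%N)
  else [::].

Definition fps_unit : {pred {fps k}} := fun f => f 0%N != 0.
Definition fps_inv f : {fps k} :=
  if f \in fps_unit then FPS (fun n => (fps_invs f n.+1)`_n) else f.

Lemma size_fps_invs f n : size (fps_invs f n) = n.
Proof. by elim: n => //= n IHn; rewrite size_rcons IHn. Qed.

Lemma nth_fps_invs f n i :
  (i < n)%N -> (fps_invs f n)`_i = (fps_invs f i.+1)`_i.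
Proof.
elim: n => // n IHn; rewrite ltnS leq_eqVlt => /predU1P[-> //|lt_in].
by rewrite [LHS]/= nth_rcons size_fps_invs lt_in IHn.
Qed.

Fact fps_mulVx : {in fps_unit, left_inverse 1 fps_inv *%R}.
Proof.
move=> f Uf; apply: fpsP => n; rewrite fps_coefM fps_coef1 /fps_inv Uf.
case: n => [|n].
  by rewrite big_ord_recl big_ord0 addr0 subnn /= mulVf.
rewrite big_ord_recr subnn.
have -> : FPS (fun m => (fps_invs f m.+1)`_m) n.+1
  = - (\sum_(i < n.+1) (fps_invs f n.+1)`_i * f (n.+1 - i)%N) / f 0.
  by rewrite [LHS]/= !nth_rcons size_rcons size_fps_invs ltnn eqxx.
rewrite divfK //; apply/eqP; rewrite subr_eq0; apply/eqP/eq_bigr => i _.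
by congr (_ * _); rewrite [RHS]nth_fps_invs.
Qed.

Fact fps_unitPl f g : g * f = 1 -> fps_unit f.
Proof.
move=> /(congr1 (fun h : {fps k} => h 0%N)).
rewrite fps_coefM big_ord_recl big_ord0 addr0 fps_coef1 => fg1.
by apply/eqP => f0; move/eqP: fg1; rewrite f0 mulr0 eq_sym oner_eq0.
Qed.

Fact fps_invr_out : {in [predC fps_unit], fps_inv =1 id}.
Proof. by move=> f; rewrite inE /fps_inv => /negbTE->. Qed.

HB.instance Definition _ := GRing.ComNzRing_hasMulInverse.Build {fps k}
  fps_mulVx fps_unitPl fps_invr_out.

Lemma fps_unitE f : (f \is a GRing.unit) = (f 0%N != 0). Proof. by []. Qed.

Lemma fps_order f : f != 0 ->
  exists2 n, f n != 0 & forall i, (i < n)%N -> f i = 0.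
Proof.
move=> f_neq0; have exf : exists n, f n != 0.
  apply: contrapT => nf; case/eqP: f_neq0; apply: fpsP => n.
  by apply: contrapT => /eqP fn; apply: nf; exists n.
case: (ex_minnP exf) => n fn min_n; exists n => // i lt_in.
by apply/eqP; apply: contraTT lt_in => /min_n; rewrite -leqNgt.
Qed.

Fact fps_mulf_eq0 : GRing.integral_domain_axiom {fps k}.
Proof.
move=> f g fg0; apply: contrapT => /negP; rewrite negb_or => /andP[].
move=> /fps_order[m fm m_min] /fps_order[n gn n_min].
suff: (f * g) (m + n)%N != 0 by rewrite fg0 eqxx.
have lt_m : (m < (m + n).+1)%N by rewrite ltnS leq_addr.
rewrite fps_coefM (bigD1 (Ordinal lt_m)) //= addKn big1 => [|i neq_im].
  by rewrite addr0 mulf_neq0.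
have [lt_im|le_mi] := ltnP i m; first by rewrite m_min ?mul0r.
rewrite [g _]n_min ?mulr0 // -(ltn_add2l i) subnKC; last first.
  by rewrite -ltnS.
by rewrite ltn_add2r ltn_neqAle le_mi andbT eq_sym neq_im.
Qed.

HB.instance Definition _ := GRing.ComUnitRing_isIntegral.Build {fps k}
  fps_mulf_eq0.

Definition fpsX : {fps k} := FPS (fun n => (n == 1%N)%:R).

Definition fps_deriv f : {fps k} := FPS (fun n => f n.+1 *+ n.+1).

Lemma fps_coefXM f n : (fpsX * f) n = if n is m.+1 then f m else 0.
Proof.
rewrite fps_coefM; case: n => [|n].
  by rewrite big_ord_recl big_ord0 mul0r addr0.
rewrite 2!big_ord_recl mul0r add0r mul1r subSS subn0 big1 ?addr0 // => i _.
by rewrite mul0r.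
Qed.

Lemma fps_coefXnM f m n :
  (fpsX ^+ m * f) n = if (n < m)%N then 0 else f (n - m)%N.
Proof.
elim: m n => [|m IHm] n; first by rewrite mul1r subn0.
by rewrite exprS -mulrA fps_coefXM; case: n => // n; rewrite IHm ltnS subSS.
Qed.

End PowerSeries.

Notation "f ^`D" := (fps_deriv f) : ring_scope.

Notation "{ 'laurent' k }" := {fraction {fps k}} (format "{ 'laurent'  k }").
Notation "x %:F" := (@FracField.tofrac _ x).

Section Laurent.
Variable k : fieldType.

Lemma fps_factor (f : {fps k}) : f != 0 ->
  exists n, exists2 u, u \is a GRing.unit & f = fpsX k ^+ n * u.
Proof.
move=> /fps_order[n fn n_min]; exists n, (FPS (fun i => f (n + i)%N)).
  by rewrite fps_unitE /= addn0.
apply: fpsP => i; rewrite fps_coefXnM; case: ltnP => [/n_min // | le_ni].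
by rewrite /= subnKC.
Qed.

Lemma cancel_frac (F : fieldType) (a b c d : F) :
  a != 0 -> a * b * c / (a * d) = b * (c / d).
Proof. by move=> a_neq0; rewrite -[a * b * c]mulrA -mulf_div divff // mul1r mulrA. Qed.

Lemma laurent_frac (x : {laurent k}) :
  exists f, exists2 h : {fps k}, h != 0 & x = f%:F / h%:F.
Proof.
elim/quotW: x => r; exists r.1, r.2; first exact: denom_ratioP.
apply: (canRL (mulfK _)); first by rewrite tofrac_eq0 denom_ratioP.
unlock FracField.tofrac; rewrite -[LHS]FracField.pi_mul; apply/eqmodP.
rewrite /= FracField.equivfE /FracField.mulf /=.
rewrite !numden_Ratio ?mulf_neq0 ?denom_ratioP //.
  by rewrite ?mulr1 1?mulrC.
all: exact: oner_neq0.
Qed.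

Lemma laurentP (x : {laurent k}) :
  exists f : {fps k}, x = f%:F \/ (f 0%N = 0 /\ x^-1 = f%:F).
Proof.
have [f [h h_neq0 ->]] := laurent_frac x.
have [->|f_neq0] := eqVneq f 0; first by exists 0; left; rewrite rmorph0 mul0r.
have X_neq0 : (fpsX k)%:F != 0.
  rewrite tofrac_eq0; apply/eqP => /(congr1 (fun f : {fps k} => f 1%N)) /eqP.
  by rewrite [X in X == _]/= oner_eq0.
have [m [u Uu ->]] := fps_factor f_neq0; have [n [v Uv ->]] := fps_factor h_neq0.
have [le_nm|lt_mn] := leqP n m.
  exists (fpsX k ^+ (m - n) * (u / v)); left.
  rewrite !rmorphM rmorphV // !rmorphXn /= -{1}(subnKC le_nm) exprD.
  by apply: cancel_frac; exact: expf_neq0 X_neq0.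
exists (fpsX k ^+ (n - m) * (v / u)); right; split.
  by case: (n - m)%N (subn_gt0 m n) lt_mn => [|i] <- // _;
    rewrite exprS -mulrA fps_coefXM.
rewrite !rmorphM rmorphV // !rmorphXn /= -{1}(subnKC (ltnW lt_mn)) exprD.
by rewrite invf_div; apply: cancel_frac; exact: expf_neq0 X_neq0.
Qed.

End Laurent.

Section ValuationRing.
Variables (k : fieldType) (g : {fps k}).

(* k(t, g): the intersection of all subfields of k((t)) containing k, t and g;
   divring_closed is closure under 1, subtraction and division. *)
Definition ktg (x : {laurent k}) : Prop :=
  forall K : {pred {laurent k}}, divring_closed K ->
    (forall a : k, (a%:A : {fps k})%:F \in K) ->
    (fpsX k)%:F \in K -> g%:F \in K -> x \in K.

Definition ktgV_pred : {pred {fps k}} := fun f => `[< ktg f%:F >].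

Lemma ktg_const (a : k) : ktg (a%:A : {fps k})%:F. Proof. by move=> K _ ->. Qed.
Lemma ktgX : ktg (fpsX k)%:F. Proof. by move=> K. Qed.
Lemma ktg_gen : ktg g%:F. Proof. by move=> K. Qed.
Lemma ktg1 : ktg 1. Proof. by move=> K []. Qed.
Lemma ktgB x y : ktg x -> ktg y -> ktg (x - y).
Proof. by move=> Kx Ky K fK ? ? ?; case: (fK) => _ + _; apply; auto. Qed.
Lemma ktg_div x y : ktg x -> ktg y -> ktg (x / y).
Proof. by move=> Kx Ky K fK ? ? ?; case: (fK) => _ _; apply; auto. Qed.
Lemma ktgV x : ktg x -> ktg x^-1.
Proof. by move=> Kx; rewrite -div1r; apply: ktg_div => //; apply: ktg1. Qed.
Lemma ktgM x y : ktg x -> ktg y -> ktg (x * y).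
Proof. by move=> Kx Ky; rewrite -[y]invrK; apply/ktg_div/ktgV. Qed.
Lemma ktgD x y : ktg x -> ktg y -> ktg (x + y).
Proof.
move=> Kx Ky; rewrite -[y]opprK; apply: ktgB => //; rewrite -sub0r.
by apply: ktgB => //; rewrite -(subrr 1); apply: ktgB; apply: ktg1.
Qed.

Fact ktgV_divalg_closed : divalg_closed ktgV_pred.
Proof.
split=> [|a f h /asboolP Kf /asboolP Kh|f h /asboolP Kf /asboolP Kh];
  apply/asboolP.
- by rewrite rmorph1; apply: ktg1.
- rewrite -mulr_algl rmorphD rmorphM.
  by apply: ktgD => //; apply: ktgM => //; apply: ktg_const.
- rewrite rmorphM; apply: ktgM => //.
  have [Uh|nUh] := boolP (h \is a GRing.unit); last by rewrite invr_out.
  by rewrite rmorphV //; apply: ktgV.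
Qed.

HB.instance Definition _ := GRing.isDivalgClosed.Build k {fps k} ktgV_pred
  ktgV_divalg_closed.

(* V = k(t, g) ∩ k[[t]], as a k-subalgebra of k[[t]] *)
Record ktg_dvr := KtgDvr { ktg_dvr_val :> {fps k}; _ : ktg_dvr_val \in ktgV_pred }.

HB.instance Definition _ := [isSub for ktg_dvr_val].
HB.instance Definition _ := [Choice of ktg_dvr by <:].
HB.instance Definition _ := [SubChoice_isSubIntegralDomain of ktg_dvr by <:].
HB.instance Definition _ := [SubZmodule_isSubLmodule of ktg_dvr by <:].
HB.instance Definition _ := [SubNzRing_SubLmodule_isSubLalgebra of ktg_dvr by <:].
HB.instance Definition _ := [SubLalgebra_isSubAlgebra of ktg_dvr by <:].

Definition ktg_dvrX : ktg_dvr := KtgDvr (asboolT ktgX).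

Lemma ktg_dvr_unitE (x : ktg_dvr) : (x \is a GRing.unit) = (x 0%N != 0).
Proof. by []. Qed.

(* ktg_dvr g is a discrete valuation ring with uniformizer t. *)
Lemma ktg_dvrX_nunit : ktg_dvrX \isn't a GRing.unit.
Proof. by rewrite ktg_dvr_unitE negbK. Qed.

Lemma ktg_dvrX_neq0 : ktg_dvrX != 0.
Proof.
apply/eqP => /(congr1 (fun x : ktg_dvr => x 1%N)) /eqP.
by rewrite [X in X == _]/= oner_eq0.
Qed.

Lemma ktg_dvr_factor (x : ktg_dvr) : x != 0 ->
  exists n, exists2 u : ktg_dvr, u \is a GRing.unit & x = ktg_dvrX ^+ n * u.
Proof.
move=> x_neq0; have [n [u Uu Dx]] := @fps_factor k (val x) x_neq0.
have X_neq0 : (fpsX k)%:F != 0 by rewrite tofrac_eq0; exact: ktg_dvrX_neq0.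
have Vu : u \in ktgV_pred.
  apply/asboolP; have -> : u%:F = (val x)%:F / (fpsX k)%:F ^+ n.
    by rewrite Dx rmorphM rmorphXn /= mulrAC divff ?mul1r ?expf_neq0.
  apply: ktg_div; first exact/asboolP/(valP x).
  elim: n {u Uu Dx} => [|n IHn]; first exact: ktg1.
  by rewrite exprS; apply: ktgM => //; apply: ktgX.
exists n, (KtgDvr Vu); first by [].
by apply: val_inj; rewrite rmorphM rmorphXn.
Qed.

(* ktg_dvr g is a valuation ring of k(t, g), with the valuation induced from
   k[[t]]: an element x outside it has x^-1 in its maximal ideal. *)
Lemma ktg_dvr_valuation x : ktg x ->
  (exists v : ktg_dvr, x = (val v)%:F) \/
  (exists2 v : ktg_dvr, v \isn't a GRing.unit & x^-1 = (val v)%:F).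
Proof.
move=> Kx; suff: exists f : {fps k}, x = f%:F \/ (f 0%N = 0 /\ x^-1 = f%:F).
  move=> [f [Dx | [f0 Dx]]].
    have Vf : f \in ktgV_pred by apply/asboolP; rewrite -Dx.
    by left; exists (KtgDvr Vf).
  have Vf : f \in ktgV_pred by apply/asboolP; rewrite -Dx; apply: ktgV.
  by right; exists (KtgDvr Vf) => //; rewrite ktg_dvr_unitE /= f0 eqxx.
exact: laurentP.
Qed.

End ValuationRing.

Section DifferentialOperators.
Variables (k : comNzRingType) (S : comAlgType k).
Implicit Types (d e : S -> S) (s x y : S) (m n : nat).

Definition commutator d s : S -> S := fun x => d (s * x) - s * d x.

(* D^n_k(S) as a set of maps; S^o is S as a module over itself, so that D^0 is
   Hom_S(S, S), whereas the second linear is linearity over k. *)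
Fixpoint is_diffop_le n d : Prop :=
  if n is m.+1 then linear d /\ forall s, is_diffop_le m (commutator d s)
  else linear (d : S^o -> S^o).

Definition is_diffop d : Prop := exists n, is_diffop_le n d.

Lemma eq_is_diffop_le n d e : d =1 e -> is_diffop_le n d -> is_diffop_le n e.
Proof. by move=> /funext->. Qed.

Lemma is_diffop0P d : linear (d : S^o -> S^o) <-> (forall x, d x = x * d 1).
Proof.
split=> [ld x | Dd a x y]; last first.
  by rewrite Dd (Dd x) (Dd y) mulrDl /GRing.scale /= mulrA.
have d0 : d 0 = 0.
  by have := ld (-1) 0 0; rewrite !scaleN1r oppr0 addr0 addNr.
by have := ld x 1 0; rewrite !addr0 d0 addr0 /GRing.scale /= mulr1.
Qed.

Lemma is_diffop_linear n d : is_diffop_le n d -> linear d.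
Proof.
case: n => [/is_diffop0P Dd a x y|n []//].
by rewrite Dd (Dd x) (Dd y) mulrDl scalerAl.
Qed.

Lemma is_diffop_le_cst0 n : is_diffop_le n (fun=> 0).
Proof.
elim: n => [|n IHn]; first by apply/is_diffop0P => x; rewrite mulr0.
split=> [a x y|s]; first by rewrite scaler0 addr0.
by apply: eq_is_diffop_le IHn => x; rewrite /commutator mulr0 subr0.
Qed.

Lemma commutator0 d s : is_diffop_le 0 d -> commutator d s =1 fun=> 0.
Proof.
by move=> /is_diffop0P Dd x; rewrite /commutator Dd (Dd x) mulrA subrr.
Qed.

Lemma is_diffop_leS n d : is_diffop_le n d -> is_diffop_le n.+1 d.
Proof.
elim: n d => [|n IHn] d Dd; split; try exact: is_diffop_linear Dd.
  move=> s; apply: eq_is_diffop_le (is_diffop_le_cst0 0) => x.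
  by rewrite commutator0.
by move=> s; apply: IHn; case: Dd => _; apply.
Qed.

Lemma is_diffop_le_trans m n d :
  (m <= n)%N -> is_diffop_le m d -> is_diffop_le n d.
Proof. by move=> /subnKC <- Dd; elim: (n - m)%N => [|i /is_diffop_leS];
  rewrite ?addn0 ?addnS. Qed.

Lemma is_diffop_leD n d e :
  is_diffop_le n d -> is_diffop_le n e -> is_diffop_le n (fun x => d x + e x).
Proof.
elim: n d e => [|n IHn] d e.
  move=> /is_diffop0P Dd /is_diffop0P De; apply/is_diffop0P => x.
  by rewrite Dd De mulrDr.
move=> [ld Dd] [le De]; split=> [a x y|s].
  by rewrite ld le scalerDr addrACA.
apply: eq_is_diffop_le (IHn _ _ (Dd s) (De s)) => x.
by rewrite /commutator mulrDr opprD addrACA.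
Qed.

Lemma is_diffop_leZ n a d : is_diffop_le n d -> is_diffop_le n (fun x => a *: d x).
Proof.
elim: n d => [|n IHn] d.
  by move=> /is_diffop0P Dd; apply/is_diffop0P => x; rewrite Dd scalerAr.
move=> [ld Dd]; split=> [b x y|s].
  by rewrite ld scalerDr !scalerA mulrC.
apply: eq_is_diffop_le (IHn _ (Dd s)) => x.
by rewrite /commutator scalerBr scalerAr.
Qed.

Lemma is_diffop_le_comp m n d e :
  is_diffop_le m d -> is_diffop_le n e -> is_diffop_le (m + n)%N (d \o e).
Proof.
move: {-1}(m + n)%N (erefl (m + n)%N) => N; elim: N m n d e => [|N IHN] m n d e.
  case: m n => [|//] [|//] _ /is_diffop0P Dd /is_diffop0P De.
  by apply/is_diffop0P => x; rewrite /= Dd De (Dd (e 1)) mulrA.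
move=> DN Dd De.
have ld := is_diffop_linear Dd; have le := is_diffop_linear De.
have d0 : d 0 = 0 by have := ld (-1) 0 0; rewrite !scaleN1r oppr0 addr0 addNr.
have dB x y : d (x - y) = d x - d y.
  by rewrite -scaleN1r addrC ld scaleN1r addrC.
split=> [a x y|s]; first by rewrite /= le ld.
have D1 : is_diffop_le N (d \o commutator e s).
  case: n DN De => [|n] DN De.
    apply: eq_is_diffop_le (is_diffop_le_cst0 _) => x.
    by rewrite /= commutator0.
  apply: (IHN m n) => //; first by move: DN; rewrite addnS => -[].
  by case: De => _; apply.
have D2 : is_diffop_le N (commutator d s \o e).
  case: m DN Dd {D1} => [|m] DN Dd.
    apply: eq_is_diffop_le (is_diffop_le_cst0 _) => x.
    by rewrite /= commutator0.
  apply: (IHN m n) => //; first by move: DN; rewrite addSn => -[].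
  by case: Dd => _; apply.
apply: eq_is_diffop_le (is_diffop_leD D1 D2) => x.
by rewrite /commutator /= dB addrA subrK.
Qed.

(* D_k(S), a k-algebra under composition *)
Record diffop := DiffOp { diffop_fun :> S -> S; _ : `[< is_diffop diffop_fun >] }.

HB.instance Definition _ := [isSub for diffop_fun].
HB.instance Definition _ := [Choice of diffop by <:].

Implicit Types (D E F : diffop).

Lemma diffopP D : is_diffop D. Proof. exact/asboolP/(valP D). Qed.
Lemma eq_diffop D E : D =1 E -> D = E.
Proof. by move=> /funext /val_inj. Qed.
Definition mk_diffop d (dP : is_diffop d) : diffop := DiffOp (asboolT dP).

Lemma diffop_linear D : linear D.
Proof. by have [n] := diffopP D; apply: is_diffop_linear. Qed.

Fact is_diffop_cst0 : is_diffop (fun=> 0).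
Proof. by exists 0%N; apply: is_diffop_le_cst0. Qed.
Fact is_diffopZ a D : is_diffop (fun x => a *: D x).
Proof. by have [n] := diffopP D; exists n; apply: is_diffop_leZ. Qed.
Fact is_diffopN D : is_diffop (fun x => - D x).
Proof.
by have := is_diffopZ (-1) D; congr is_diffop; apply/funext => x; rewrite scaleN1r.
Qed.
Fact is_diffopD D E : is_diffop (fun x => D x + E x).
Proof.
have [[m Dm] [n En]] := (diffopP D, diffopP E); exists (maxn m n).
by apply: is_diffop_leD; [apply: is_diffop_le_trans Dm; apply: leq_maxl
                         |apply: is_diffop_le_trans En; apply: leq_maxr].
Qed.
Fact is_diffop_id : is_diffop id.
Proof. by exists 0%N; apply/is_diffop0P => x; rewrite mulr1. Qed.
Fact is_diffop_comp D E : is_diffop (D \o E).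
Proof.
have [[m Dm] [n En]] := (diffopP D, diffopP E).
by exists (m + n)%N; apply: is_diffop_le_comp.
Qed.

Definition diffop_zero := mk_diffop is_diffop_cst0.
Definition diffop_opp D := mk_diffop (is_diffopN D).
Definition diffop_add D E := mk_diffop (is_diffopD D E).
Definition diffop_scale a D := mk_diffop (is_diffopZ a D).
Definition diffop_one := mk_diffop is_diffop_id.
Definition diffop_mul D E := mk_diffop (is_diffop_comp D E).

Fact diffop_addA : associative diffop_add.
Proof. by move=> D E F; apply: eq_diffop => x; exact: addrA. Qed.
Fact diffop_addC : commutative diffop_add.
Proof. by move=> D E; apply: eq_diffop => x; exact: addrC. Qed.
Fact diffop_add0 : left_id diffop_zero diffop_add.
Proof. by move=> D; apply: eq_diffop => x; exact: add0r. Qed.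
Fact diffop_addN : left_inverse diffop_zero diffop_opp diffop_add.
Proof. by move=> D; apply: eq_diffop => x; exact: addNr. Qed.

HB.instance Definition _ := GRing.isZmodule.Build diffop
  diffop_addA diffop_addC diffop_add0 diffop_addN.

Fact diffop_mulA : associative diffop_mul.
Proof. by move=> D E F; apply: eq_diffop. Qed.
Fact diffop_mul1 : left_id diffop_one diffop_mul.
Proof. by move=> D; apply: eq_diffop. Qed.
Fact diffop_mulr1 : right_id diffop_one diffop_mul.
Proof. by move=> D; apply: eq_diffop. Qed.
Fact diffop_mulDl : left_distributive diffop_mul +%R.
Proof. by move=> D E F; apply: eq_diffop. Qed.
Fact diffop_mulDr : right_distributive diffop_mul +%R.
Proof.
move=> D E F; apply: eq_diffop => x /=.
by have := diffop_linear D 1 (E x) (F x); rewrite !scale1r.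
Qed.
Fact diffop_oner_neq0 : diffop_one != 0.
Proof. by apply/eqP => /(congr1 (fun D : diffop => D 1)) /eqP; rewrite oner_eq0. Qed.

HB.instance Definition _ := GRing.Zmodule_isNzRing.Build diffop
  diffop_mulA diffop_mul1 diffop_mulr1 diffop_mulDl diffop_mulDr
  diffop_oner_neq0.

Fact diffop_scaleA a b D : diffop_scale a (diffop_scale b D) = diffop_scale (a * b) D.
Proof. by apply: eq_diffop => x; exact: scalerA. Qed.
Fact diffop_scale1 : left_id 1 diffop_scale.
Proof. by move=> D; apply: eq_diffop => x; exact: scale1r. Qed.
Fact diffop_scaleDr : right_distributive diffop_scale +%R.
Proof. by move=> a D E; apply: eq_diffop => x; exact: scalerDr. Qed.
Fact diffop_scaleDl D : {morph diffop_scale^~ D : a b / a + b}.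
Proof. by move=> a b; apply: eq_diffop => x; exact: scalerDl. Qed.

HB.instance Definition _ := GRing.Zmodule_isLmodule.Build k diffop
  diffop_scaleA diffop_scale1 diffop_scaleDr diffop_scaleDl.

Fact diffop_scaleAl a D E : a *: (D * E) = (a *: D) * E.
Proof. by apply: eq_diffop. Qed.

HB.instance Definition _ := GRing.Lmodule_isLalgebra.Build k diffop diffop_scaleAl.

Fact diffop_scaleAr a D E : a *: (D * E) = D * (a *: E).
Proof.
apply: eq_diffop => x /=; have lD := diffop_linear D.
have D0 : D 0 = 0 by have := lD (-1) 0 0; rewrite !scaleN1r oppr0 addr0 addNr.
by have := lD a (E x) 0; rewrite !addr0 D0 addr0.
Qed.

HB.instance Definition _ := GRing.Lalgebra_isAlgebra.Build k diffop diffop_scaleAr.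

Fact is_diffop_mulop s : is_diffop ( *%R s).
Proof. by exists 0%N; apply/is_diffop0P => x; rewrite mulr1 mulrC. Qed.

Definition mulop s : diffop := mk_diffop (is_diffop_mulop s).

Fact mulop_linear : linear mulop.
Proof.
by move=> a s y; apply: eq_diffop => x; rewrite /= mulrDl scalerAl.
Qed.
Fact mulop_monoid : monoid_morphism mulop.
Proof.
by split=> [|s y]; apply: eq_diffop => x; rewrite /= ?mul1r ?mulrA.
Qed.

HB.instance Definition _ := GRing.isLinear.Build k S diffop *:%R mulop mulop_linear.
HB.instance Definition _ := GRing.isMonoidMorphism.Build S diffop mulop mulop_monoid.

End DifferentialOperators.

(* Main.v *)
Require Import Defs.
From mathcomp Require Import all_boot all_algebra.
From mathcomp Require Import boolp ring.
Import GRing.Theory.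
Local Open Scope ring_scope.

(* Subtracting D(1) from an operator D of order at most 1 leaves a derivation
   delta of V.  Writing f = f(0) + t h with h in V gives
     delta f - f' delta t = t (delta h - h' delta t),
   so that iterating this, delta f - f' delta t is divisible by every power of
   t, that is, delta f = f' delta t.  For f = g this puts g' in k(t, g) unless
   delta t = 0, whence delta = 0.  Operators of order n reduce to order 1, since
   by induction all their commutators with V have order 0. *)

Section Derivations.
Variables (k : fieldType) (g : {fps k}).
Local Notation V := (ktg_dvr g).
Local Notation t := (ktg_dvrX g).

Lemma fpsX_neq0 : fpsX k != 0.
Proof. exact: (ktg_dvrX_neq0 g). Qed.

(** The shifted series equals [(f - f(0)) / t], a quotient inside k(t, g), so it stays in [V]. *)
Lemma ktg_dvr_shift (f : V) : exists h : V, f = (val f 0%N)%:A + t * h.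
Proof.
pose h : {fps k} := FPS (fun n => val f n.+1).
have Df : val f = (val f 0%N)%:A + fpsX k * h.
  apply: fpsP => n; rewrite fps_coefD fps_coefXM fps_coefZ fps_coef1.
  by case: n => [|n]; rewrite ?mulr1 ?mulr0 ?addr0 ?add0r.
have Vh : h \in ktgV_pred g.
  apply/asboolP.
  have -> : h%:F =
      ((val f)%:F - ((val f 0%N)%:A : {fps k})%:F) / (fpsX k)%:F.
    rewrite -rmorphB {1}Df addrC addKr rmorphM /= mulrC mulKf //.
    by rewrite tofrac_eq0 fpsX_neq0.
  apply: ktg_div; last exact: ktgX.
  apply: ktgB; [exact/asboolP/(valP f) | exact: ktg_const].
by exists (KtgDvr Vh); apply: val_inj.
Qed.

(** At degree [n] the factor [n + 1] splits as [1 + n]: the two parts come from [h] and from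
    [t h']. *)
Lemma fps_derivD_XM (a : k) (h : {fps k}) :
  (a%:A + fpsX k * h)^`D = h + fpsX k * h^`D.
Proof.
apply: fpsP => n; rewrite -[LHS]/((a%:A + fpsX k * h) n.+1 *+ n.+1).
rewrite !fps_coefD !fps_coefXM fps_coefZ fps_coef1 mulr0 add0r.
by case: n => [|n]; rewrite ?mulr1n ?addr0 // mulrS.
Qed.

Variable d : V -> V.
Hypothesis d_linear : linear d.
Hypothesis d_leibniz : forall x y, d (x * y) = x * d y + y * d x.

Lemma derivation_dvr (f : V) : val (d f) = (val f)^`D * val (d t).
Proof.
have d1 : d 1 = 0.
  (* The Leibniz rule gives [d 1 = d 1 + d 1]. *)
  have := d_leibniz 1 1; rewrite !mul1r => /eqP.
  by rewrite -[X in X == _]addr0 (inj_eq (addrI _)) eq_sym => /eqP.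
have step (h : V) a : val (d (a%:A + t * h)) =
    val h * val (d t) + fpsX k * val (d h).
  by rewrite d_linear d1 scaler0 add0r d_leibniz addrC.
(* Both sides share the term [h * d t]; the rest is a multiple of [t], so coefficient [n + 1] for
   [f] reduces to coefficient [n] for [h]. Hence [f] is generalized. *)
apply: fpsP => n; elim: n f => [|n IHn] f; have [h ->] := ktg_dvr_shift f;
  rewrite step fps_derivD_XM mulrDl -mulrA !fps_coefD !fps_coefXM //.
by rewrite IHn.
Qed.

Lemma derivation_dvr_eq0 : ~ ktg g (g^`D)%:F -> forall f, d f = 0.
Proof.
move=> dg; suff dt0 : d t = 0.
  by move=> f; apply: val_inj; rewrite derivation_dvr dt0 mulr0.
apply: contrapT => /eqP dt_neq0; apply: dg.
pose G : V := KtgDvr (asboolT (@ktg_gen k g)).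
have -> : (g^`D)%:F = (val (d G))%:F / (val (d t))%:F.
  by rewrite derivation_dvr rmorphM mulfK // tofrac_eq0.
by apply: ktg_div;
  [exact/asboolP/(valP (d G)) | exact/asboolP/(valP (d t))].
Qed.

End Derivations.

Section OrderReduction.
Variables (k : comNzRingType) (S : comAlgType k).

(** The commutator of [d] with [x] has order 0, so it is multiplication by its value [d x - x * d 1]
    at 1. *)
Lemma diffop_le1_leibniz (d : S -> S) : is_diffop_le 1 d ->
  forall x y, d (x * y) - x * y * d 1
    = x * (d y - y * d 1) + y * (d x - x * d 1).
Proof.
move=> [_ Dd] x y; have /is_diffop0P/(_ y) := Dd x.
rewrite /commutator mulr1 => /eqP; rewrite subr_eq => /eqP ->; ring.
Qed.

Lemma is_diffop_le_0 :
  (forall d : S -> S, is_diffop_le 1 d -> is_diffop_le 0 d) ->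
  forall n (d : S -> S), is_diffop_le n d -> is_diffop_le 0 d.
Proof.
move=> le10; elim=> [//|n IHn] d [ld Dd].
by apply: le10; split=> // s; apply/IHn/Dd.
Qed.

End OrderReduction.

Theorem theorem4p3 (k : fieldType) (g : {fps k}) (g0 : g 0%N = 0)
    (dg : ~ ktg g (g^`D)%:F) :
  bijective (@mulop k (ktg_dvr g) : {lrmorphism ktg_dvr g -> diffop (ktg_dvr g)}).
Proof.
exists (fun D : diffop (ktg_dvr g) => D 1) => [v|D]; first exact: mulr1.
(* [Dn] still awaits the reduction from order 1 to order 0, which is proved last. *)
have [n /is_diffop_le_0 Dn] := diffopP D.
apply: eq_diffop => x /=; rewrite mulrC; apply/esym; move: x.
apply/is_diffop0P/Dn => d d1; apply/is_diffop0P => x.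
apply/eqP; rewrite -subr_eq0; apply/eqP.
apply: (derivation_dvr_eq0 k g (fun x => d x - x * d 1)) => // [a y z|].
  by rewrite (is_diffop_linear d1) mulrDl -scalerAl scalerBr opprD addrACA.
exact: diffop_le1_leibniz.
Qed.
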